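(* Let $q=2^m$, let $t\ge 2$, and let $H\subset K=AG(2,q)$ be a star-set (with parameter $t$). Let $$E=\Big\{\sum_{j=0}^{m-1}2^jx_j>0 \ \Big|\ x_j\in\{0,1,q\}\Big\}.$$ Then $H$ is a KM-arc of type $t$ with $t$-nucleus at $0$ if and only if $\pi_e(H):=\sum_{y\in H}y^e=0$ for all $e\in E$.
   Context: Let $q=2^m$ ($m\ge1$), $F=\mathbb{F}_q$, $K=\mathbb{F}_{q^2}\supset F$. For $x\in K$ put $\bar x=x^q$. Let $S=\{u\in K\mid u\bar u=1\}$ and $\langle x,y\rangle=x\bar y+\bar x y\in F$ for $x,y\in K$. The projective plane $PG(2,q)$ is represented as follows: points are pairs $(x:z)$ with $x\in K$, $z\in F$, $(x,z)\neq(0,0)$, up to multiplication by $F^*$; lines are $[\alpha:\beta]=\{(x:z)\mid \langle\alpha,x\rangle+\beta z=0\}$ with $\alpha\in K$, $\beta\in F$, $(\alpha,\beta)\ne(0,0)$. The line at infinity is $[0:1]$. The affine plane $AG(2,q)=PG(2,q)\setminus[0:1]$ is identified with $K$ via $(x:1)\leftrightarrow x$; its lines are $\{x\in K\mid\langle u,x\rangle+\mu=0\}$ with $u\in S$, $\mu\in F$. A KM-arc of type $t$ in $PG(2,q)$ is a set of $q+t$ points meeting every line in $0$, $2$ or $t$ points. A $t$-secant is a line meeting it in exactly $t$ points. For $2<t<q$ it is known that all $t$-secants of a KM-arc of type $t$ pass through one common point, called its $t$-nucleus. For $t=2$ any point not on $H$ is regarded as a $2$-nucleus of $H$. Star-set: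 for $t\ge2$, a set $H$ of $q+t$ points of $K=AG(2,q)$ is a star-set if all points of $H$ belong to a union of $\frac{q}{t}+1$ lines concurrent at $0$ (in particular $t\mid q$), and each of these lines contains $t$ points of $H$. *)

(* Defs.v *)
From HB Require Import structures.
From mathcomp Require Import all_boot all_algebra.
Set Implicit Arguments.
Unset Strict Implicit.
Unset Printing Implicit Defensive.
Import GRing.Theory.
Local Open Scope ring_scope.

(* Throughout, K is meant to be a field with q ^ 2 elements; its subfield with
   q elements is the set of fixed points of x |-> x ^+ q. *)
Definition baseF (K : finFieldType) (q : nat) : {set K} :=
  [set x | x ^+ q == x].

Definition conjq (K : finFieldType) (q : nat) (x : K) : K := x ^+ q.

Definition unit_circle (K : finFieldType) (q : nat) : {set K} :=
  [set u | u * conjq q u == 1].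

Definition pairing (K : finFieldType) (q : nat) (x y : K) : K :=
  x * conjq q y + conjq q x * y.

(* Nonzero vectors of K x F, serving as homogeneous coordinates (x, z) of points
   as well as (alpha, beta) of lines. *)
Definition hcoords (K : finFieldType) (q : nat) : {set K * K} :=
  [set v | (v.2 \in baseF K q) && (v != (0, 0))].

(* The point (x : z) is the orbit of (x, z) under F^*. *)
Definition pg_point (K : finFieldType) (q : nat) (v : K * K) : {set K * K} :=
  [set (c * v.1, c * v.2) | c in baseF K q :\ 0].

Definition pg_points (K : finFieldType) (q : nat) : {set {set K * K}} :=
  [set pg_point q v | v in hcoords K q].

(* The line [alpha : beta], w = (alpha, beta), as its set of points. *)
Definition pg_line (K : finFieldType) (q : nat) (w : K * K) :
    {set {set K * K}} :=
  [set pg_point q v | v in hcoords K q & pairing q w.1 v.1 + w.2 * v.2 == 0].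

Definition pg_lines (K : finFieldType) (q : nat) : {set {set {set K * K}}} :=
  [set pg_line q w | w in hcoords K q].

Definition ag_point (K : finFieldType) (q : nat) (x : K) : {set K * K} :=
  pg_point q (x, 1).

Definition ag_lines (K : finFieldType) (q : nat) : {set {set K}} :=
  [set [set x : K | pairing q u x + mu == 0]
     | u in unit_circle K q, mu in baseF K q].

Definition KM_arc (K : finFieldType) (q t : nat) (A : {set {set K * K}}) :
    Prop :=
  [/\ A \subset pg_points K q,
      #|A| = (q + t)%N
    & forall l, l \in pg_lines K q -> #|A :&: l| \in [:: 0; 2; t]%N].

Definition secant (K : finFieldType) (q t : nat) (A l : {set {set K * K}}) :
    bool :=
  (l \in pg_lines K q) && (#|A :&: l| == t).

(* For t = 2 every point off A counts as a nucleus; otherwise a nucleus is a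
   point common to all t-secants.  Meaningful for a KM-arc A of type t. *)
Definition nucleus (K : finFieldType) (q t : nat) (A : {set {set K * K}})
    (N : {set K * K}) : Prop :=
  N \in pg_points K q /\
  (if (t == 2)%N then N \notin A : Prop
   else forall l, secant q t A l -> N \in l).

(* The condition t %| q makes the truncating quotient q %/ t exact. *)
Definition star_set (K : finFieldType) (q t : nat) (H : {set K}) : Prop :=
  [/\ (t %| q)%N,
      #|H| = (q + t)%N
    & exists L : {set {set K}},
        [/\ L \subset ag_lines K q,
            #|L| = (q %/ t + 1)%N,
            forall l, l \in L -> 0 \in l,
            H \subset cover L
          & forall l, l \in L -> #|H :&: l| = t]].

Definition expE (m e : nat) : Prop :=
  (0 < e)%N /\
  exists x : 'I_m -> nat,
    (forall j, x j \in [:: 0; 1; 2 ^ m]%N) /\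
    e = (\sum_(j < m) 2 ^ j * x j)%N.

Definition power_sum (K : finFieldType) (H : {set K}) (e : nat) : K :=
  \sum_(y in H) y ^+ e.

(* Main.v *)
Require Import Defs.
From mathcomp Require Import all_boot all_algebra all_field.
From mathcomp Require Import ring zify.
Import GRing.Theory.
Local Open Scope ring_scope.

(** Both sides of the equivalence say that every affine line missing the origin
    meets H in an even number of points.

    Algebra.  Such a line is the set of x with <a, x> = 1 for a unique a <> 0.
    Since <a, y> lies in F, the element (1 + <a, y>) ^ (q - 1) is 0 when y is on
    the line and 1 otherwise, so its sum over y in H is |H| + |H meet line| in
    characteristic 2, and |H| is even for a star-set.  As q - 1 is the sum of
    the 2 ^ j for j < m, this power is the product over j of
    1 + a ^ (q 2 ^ j) y ^ (2 ^ j) + a ^ (2 ^ j) y ^ (q 2 ^ j).  Expanded, it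
    gives one monomial per choice of digits x_j in {0, 1, q}: the exponent of y
    is the sum of the 2 ^ j x_j and that of a is the same sum with the digits 1
    and q exchanged.  Hence the parity of a chord is the value at a of a
    polynomial whose coefficients are the power sums of H (power_poly,
    horner_power_poly).  The exponents of a are pairwise distinct and smaller
    than q ^ 2, so this polynomial vanishes on all of K exactly when all the
    power sums vanish (power_sums_even_chords).

    Geometry.  In a KM-arc of type t all intersection numbers 0, 2, t are even,
    because t divides the power q of 2.  Conversely let all chords missing the
    origin be even and let y be a point of H on the star line l.  There are q
    lines through y other than l, each of which contains a second point of H by
    parity; these second points lie off l, and H has exactly q points off l.
    So each of these lines contains exactly one further point of H
    (even_chord_card), and 2 and 0 are the only chord sizes away from the
    origin.  Lines through the origin meet H in 0 or t points by the star shape,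
    so for t > 2 every t-secant passes through 0; for t = 2 the origin is a
    nucleus because it is not in H. *)

(** * Exponents with digits 0, 1 and q *)

Lemma binary_sum_inj (m : nat) (b c : 'I_m -> bool) :
  (\sum_(j < m) 2 ^ j * b j = \sum_(j < m) 2 ^ j * c j)%N -> b =1 c.
Proof.
elim: m b c => [|m IHm] b c; first by move=> _ [].
have shift (d : 'I_m.+1 -> bool) :
    (\sum_(j < m.+1) 2 ^ j * d j
     = d ord0 + (\sum_(j < m) 2 ^ j * d (lift ord0 j)).*2)%N.
  rewrite big_ord_recl mul1n -mul2n big_distrr /=; congr (_ + _)%N.
  by apply: eq_bigr => j _; rewrite expnS mulnA.
rewrite !shift => eq_bc.
have eq0 : b ord0 = c ord0.
  by have:= congr1 odd eq_bc; rewrite !oddD !odd_double !addbF; do 2!case: (_ ord0).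
move: eq_bc; rewrite eq0 => /addnI/double_inj/IHm eq_lift j.
by case: (unliftP ord0 j) => [k|] ->; [apply: eq_lift|].
Qed.

Lemma binary_sum_lt (m : nat) (b : 'I_m -> bool) :
  (\sum_(j < m) 2 ^ j * b j < 2 ^ m)%N.
Proof.
rewrite -[X in (_ < X)%N]prednK ?expn_gt0 // ltnS predn_exp mul1n.
by apply: leq_sum => j _; case: (b j); rewrite ?muln1 ?muln0.
Qed.

(** The three terms of 1 + a ^ q y + a y ^ q are indexed by 'I_3: digit gives the
    power of y and codigit that of a. *)
Definition digit (q : nat) (i : 'I_3) : nat := nth 0%N [:: 0; 1; q]%N i.

Definition codigit (q : nat) (i : 'I_3) : nat := nth 0%N [:: 0; q; 1]%N i.

Definition exponent (m : nat) (d : 'I_3 -> nat) (f : {ffun 'I_m -> 'I_3}) : nat :=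
  (\sum_(j < m) 2 ^ j * d (f j))%N.

Lemma exponent_codigit (m : nat) (f : {ffun 'I_m -> 'I_3}) :
  exponent m (codigit (2 ^ m)) f
  = (\sum_(j < m) 2 ^ j * (f j == 1 :> nat) * 2 ^ m
     + \sum_(j < m) 2 ^ j * (f j == 2 :> nat))%N.
Proof.
rewrite /exponent -big_split; apply: eq_bigr => j _ /=.
by case: (f j) => [[|[|[|//]]] lti] /=; rewrite /codigit /= ?muln0 ?muln1 ?addn0.
Qed.

(** Quotient and remainder by q separate the positions of the digit q from those
    of the digit 1, each of which is determined by its binary sum. *)
Lemma exponent_codigit_inj (m : nat) :
  injective (exponent m (codigit (2 ^ m))).
Proof.
move=> f g; rewrite !exponent_codigit -!big_distrl /= => eq_fg.
have q_gt0 : (0 < 2 ^ m)%N by rewrite expn_gt0.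
have := congr1 (divn^~ (2 ^ m)%N) eq_fg; have := congr1 (modn^~ (2 ^ m)%N) eq_fg.
rewrite /= !modnMDl !modn_small ?binary_sum_lt //.
rewrite !divnMDl // !divn_small ?binary_sum_lt // !addn0.
move=> /binary_sum_inj eq2 /binary_sum_inj eq1.
apply/ffunP => j; have := eq1 j; have := eq2 j.
by case: (f j) (g j) => [[|[|[|//]]] ?] [[|[|[|//]]] ?] //= _ _; apply: val_inj.
Qed.

Lemma exponent_codigit_lt (m : nat) (f : {ffun 'I_m -> 'I_3}) :
  (exponent m (codigit (2 ^ m)) f < (2 ^ m) ^ 2)%N.
Proof.
rewrite exponent_codigit -big_distrl /= -mulnn.
apply: leq_trans (leq_mul (binary_sum_lt m (fun j => f j == 1 :> nat)%N) (leqnn _)).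
by rewrite addnC mulSn -addSn leq_add2r binary_sum_lt.
Qed.

(** * The form on K and its fibres *)

Section Plane.

Variables (m : nat) (K : finFieldType).
Hypotheses (m_gt0 : (0 < m)%N) (cardK : #|K| = ((2 ^ m) ^ 2)%N).

Local Notation q := (2 ^ m)%N.
Local Notation "<< x , y >>" := (pairing q x y).

Lemma char2 : 2%N \in [pchar K].
Proof. by apply: (@card_finPcharP _ _ (m * 2)) => //; rewrite cardK expnM. Qed.

Lemma addKK (x : K) : x + x = 0.
Proof. exact: (addrr_pchar2 char2). Qed.

Lemma eq_add0 (x y : K) : (x + y == 0) = (x == y).
Proof. by rewrite -[X in x + X](oppr_pchar2 char2) subr_eq0. Qed.

(** Covers both the conjugation (j = m) and the factors of the expansion of a
    (q - 1)-st power. *)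
Lemma exprD_2pow (j : nat) (x y : K) :
  (x + y) ^+ (2 ^ j) = x ^+ (2 ^ j) + y ^+ (2 ^ j).
Proof. by apply: exprDn_pchar; rewrite pnatX pnatE ?char2. Qed.

Lemma conjqD (x y : K) : conjq q (x + y) = conjq q x + conjq q y.
Proof. exact: exprD_2pow. Qed.

Lemma conjqK (x : K) : conjq q (conjq q x) = x.
Proof. by rewrite /conjq -exprM mulnn -cardK expf_card. Qed.

Lemma pairing_baseF (x y : K) : << x, y >> \in baseF K q.
Proof.
rewrite inE; apply/eqP; change (conjq q << x, y >> = << x, y >>).
by rewrite {1}/pairing conjqD /conjq !exprMn -!/(conjq q _) !conjqK addrC.
Qed.

Lemma pairingDl (x y z : K) : << x + y, z >> = << x, z >> + << y, z >>.
Proof. rewrite /pairing conjqD; ring. Qed.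

Lemma pairingC (x y : K) : << x, y >> = << y, x >>.
Proof. rewrite /pairing; ring. Qed.

Lemma pairingZ (c x y : K) : c \in baseF K q -> << c * x, y >> = c * << x, y >>.
Proof.
by rewrite inE => /eqP Fc; rewrite /pairing /conjq exprMn Fc; ring.
Qed.

(** In characteristic 2 the form is alternating, so on the F-plane K the vectors
    orthogonal to a nonzero y are its F-multiples.  The computation avoids
    speaking of multiples: orthogonality of x and y means that x times the
    conjugate of y is fixed by conjugation. *)
Lemma pairing_trans (x y z : K) :
  y != 0 -> << x, y >> = 0 -> << y, z >> = 0 -> << x, z >> = 0.
Proof.
move=> y0 /eqP; rewrite eq_add0 => /eqP xy /eqP; rewrite eq_add0 => /eqP yz.
have yy0 : conjq q y * y != 0 by rewrite mulf_neq0 // expf_neq0.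
apply: (mulfI yy0); rewrite mulr0 /pairing.
have -> : conjq q y * y * (x * conjq q z + conjq q x * z)
   = (x * conjq q y) * (y * conjq q z) + (conjq q x * y) * (conjq q y * z) by ring.
by rewrite xy yz addKK.
Qed.

Lemma q_gt1 : (1 < q)%N.
Proof. by rewrite -[1%N](expn0 2) ltn_exp2l. Qed.

Lemma card_baseF_le : (#|baseF K q| <= q)%N.
Proof.
have szp : size ('X^q - 'X : {poly K}) = q.+1.
  by rewrite size_polyDl ?size_polyXn // size_polyN size_polyX ltnS q_gt1.
rewrite -ltnS -szp cardE; apply: max_poly_roots (enum_uniq _).
  by rewrite -size_poly_gt0 szp.
by apply/allP => x; rewrite mem_enum inE rootE !hornerE subr_eq0.
Qed.

Lemma card_pairing_le (y c : K) : y != 0 -> (#|[set a | << a, y >> == c]| <= q)%N.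
Proof.
move=> y0; set p : {poly K} := y *: 'X^q + (conjq q y *: 'X - c%:P).
have szp : size p = q.+1.
  have szX : size (y *: 'X^q) = q.+1 by rewrite size_scale // size_polyXn.
  rewrite size_polyDl ?szX // ltnS.
  apply: leq_trans q_gt1; rewrite (leq_trans (size_polyD _ _)) //.
  rewrite size_polyN geq_max (leq_trans (size_scale_leq _ _)) ?size_polyX //.
  by rewrite (leq_trans (size_polyC_leq1 _)).
rewrite -ltnS -szp cardE; apply: max_poly_roots (enum_uniq _).
  by rewrite -size_poly_gt0 szp.
apply/allP => x /=; rewrite mem_enum inE rootE /p => /eqP <-.
rewrite !hornerD hornerN !hornerZ hornerXn hornerX hornerC.
by apply/eqP; rewrite /pairing /conjq; ring.
Qed.

(** The q ^ 2 elements of K are spread over at most q fibres, and each fibre is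
    the root set of a polynomial of degree q; hence every fibre is full. *)
Lemma card_pairing (y c : K) :
  y != 0 -> c \in baseF K q -> #|[set a | << a, y >> == c]| = q.
Proof.
move=> y0 Fc.
have fibers : (\sum_(d in baseF K q) #|[set a | << a, y >> == d]| = q * q)%N.
  rewrite mulnn -cardK -sum1_card.
  rewrite [RHS](partition_big (fun a => << a, y >>) (mem (baseF K q))) /=; last first.
    by move=> a _; apply: pairing_baseF.
  by apply: eq_bigr => d _; rewrite -sum1dep_card.
have le_fiber d : d \in baseF K q ->
    (#|[set a | << a, y >> == d]| <= q ?= iff (#|[set a | << a, y >> == d]| == q))%N.
  by move=> _; split; rewrite ?card_pairing_le.
have := leqif_sum le_fiber; rewrite fibers sum_nat_const => -[le_sum eq_sum].
apply/eqP; have: (q * q == #|baseF K q| * q)%N.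
  by rewrite eqn_leq le_sum leq_mul2r card_baseF_le orbT.
by rewrite eq_sum => /forallP/(_ c); rewrite Fc.
Qed.

(** * Power sums and the parity of chords *)

(** Lines missing the origin are parametrised by a <> 0; for a = 0 the chord is
    empty, which makes uniform statements over all of K possible. *)
Definition chord (H : {set K}) (a : K) : {set K} := [set y in H | << a, y >> == 1].

(** For |H| even, its value at a is the parity of the chord at a, by
    horner_power_poly. *)
Definition power_poly (H : {set K}) : {poly K} :=
  \sum_(f : {ffun 'I_m -> 'I_3})
    power_sum H (exponent m (digit q) f) *: 'X^(exponent m (codigit q) f).

Lemma indicator_baseF (s : K) : s \in baseF K q -> (1 + s) ^+ q.-1 = (s != 1)%:R.
Proof.
rewrite inE => /eqP Fs; have [->|s1] := eqVneq s 1.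
  by rewrite addKK expr0n -subn1 subn_eq0 leqNgt q_gt1.
apply: (@mulfI _ (1 + s)); first by rewrite eq_add0 eq_sym.
by rewrite -exprS prednK ?expn_gt0 // exprD_2pow expr1n Fs mulr1.
Qed.

Lemma expand_indicator (a y : K) :
  (1 + << a, y >>) ^+ q.-1
  = \sum_(f : {ffun 'I_m -> 'I_3})
      y ^+ exponent m (digit q) f * a ^+ exponent m (codigit q) f.
Proof.
rewrite predn_exp mul1n expr_sum.
under eq_bigr => j _.
  rewrite !exprD_2pow expr1n.
  rewrite (_ : _ + _ = \sum_(i < 3)
      y ^+ (2 ^ j * digit q i) * a ^+ (2 ^ j * codigit q i)).
    over.
  rewrite !big_ord_recl big_ord0 /digit /codigit /= !muln0 !muln1 /conjq.
  by rewrite !exprMn -!exprM ![(q * _)%N]mulnC; ring.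
rewrite bigA_distr_bigA; apply: eq_bigr => f _.
by rewrite big_split /= /exponent !expr_sum.
Qed.

Lemma horner_power_poly (H : {set K}) (a : K) :
  (power_poly H).[a] = #|H|%:R + #|chord H a|%:R.
Proof.
rewrite /power_poly horner_sum.
under eq_bigr => f _ do rewrite hornerZ hornerXn /power_sum big_distrl.
rewrite exchange_big /= -!sum1_card !natr_sum [X in _ + X]big_mkcond /=.
rewrite [X in X + _]big_mkcond -big_split big_mkcond /=; apply: eq_bigr => y _.
rewrite inE; case: (y \in H) => /=; last by rewrite addr0.
rewrite -expand_indicator indicator_baseF ?pairing_baseF //.
by case: eqP => _; rewrite ?addKK ?addr0.
Qed.

Lemma coef_power_poly (H : {set K}) (f : {ffun 'I_m -> 'I_3}) :
  (power_poly H)`_(exponent m (codigit q) f) = power_sum H (exponent m (digit q) f).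
Proof.
rewrite coef_sum (bigD1 f) //= coefZ coefXn eqxx mulr1 big1 ?addr0 // => g gf.
rewrite coefZ coefXn; case: eqP => [/exponent_codigit_inj fg|_]; last by rewrite mulr0.
by rewrite fg eqxx in gf.
Qed.

(** This bound is what turns a vanishing function on K into a vanishing
    polynomial. *)
Lemma size_power_poly (H : {set K}) : (size (power_poly H) <= #|K|)%N.
Proof.
rewrite cardK; apply: (leq_trans (size_sum _ _ _)); apply/bigmax_leqP => f _.
by rewrite (leq_trans (size_scale_leq _ _)) // size_polyXn exponent_codigit_lt.
Qed.

Lemma power_poly_eq0 (H : {set K}) :
  (forall a, (power_poly H).[a] = 0) -> power_poly H = 0.
Proof.
move=> P0; apply: (@roots_geq_poly_eq0 _ _ (enum K)).
- by apply/allP => a _; apply/rootP/P0.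
- exact: enum_uniq.
- by rewrite -cardE size_power_poly.
Qed.

Lemma odd_natr (n : nat) : (n%:R == 0 :> K) = ~~ odd n.
Proof. by rewrite -(dvdn_pcharf char2) dvdn2. Qed.

Lemma expE_digits (e : nat) :
  expE m e <-> (0 < e)%N /\ exists f, e = exponent m (digit q) f.
Proof.
split=> -[e0]; last first.
  case=> f ef; split=> //; exists (fun j => digit q (f j)); split=> // j.
  by case: (f j) => [[|[|[|//]]] ?]; rewrite /digit !inE /= ?eqxx ?orbT.
case=> x [xE ex]; split=> //.
exists [ffun j => inord (index (x j) [:: 0; 1; q]%N)]; rewrite ex.
apply: eq_bigr => j _.
by rewrite ffunE /digit inordK ?nth_index // -[3%N]/(size [:: 0; 1; q]%N) index_mem.
Qed.

Lemma power_sums_even_chords (H : {set K}) :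
  ~~ odd #|H| ->
  (forall e, expE m e -> power_sum H e = 0) <-> (forall a, ~~ odd #|chord H a|).
Proof.
rewrite -odd_natr => /eqP evenH; split=> [sums0 a|even_chords e].
  have P0: power_poly H = 0.
    apply: big1 => f _.
    (* The exponent 0 is excluded from E; its power sum is |H|, which is even. *)
    have [e0|e_gt0] := posnP (exponent m (digit q) f).
      rewrite e0 /power_sum (eq_bigr (fun=> 1)) ?sumr_const ?evenH ?scale0r //.
    by rewrite sums0 ?scale0r //; apply/expE_digits; split; last by exists f.
  have := horner_power_poly H a; rewrite P0 horner0 evenH add0r => eq0.
  by rewrite -odd_natr -eq0.
case/expE_digits=> _ [f ->]; rewrite -coef_power_poly power_poly_eq0 ?coef0 // => a.
by rewrite horner_power_poly evenH add0r; apply/eqP; rewrite odd_natr.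
Qed.

(** * Incidence in the affine plane *)

Lemma pairing0r (x : K) : << x, 0 >> = 0.
Proof. by rewrite /pairing /conjq expr0n expn_eq0 /= !mulr0 addr0. Qed.

Lemma pairingDr (x y z : K) : << x, y + z >> = << x, y >> + << x, z >>.
Proof. by rewrite pairingC pairingDl ![<< _, x >>]pairingC. Qed.

Lemma pairing_pencil (u v y x : K) :
  u != 0 -> y != 0 -> << u, y >> = 0 -> << v, y >> = 0 ->
  << u, x >> = 0 -> << v, x >> = 0.
Proof.
move=> u0 y0 uy vy; apply: pairing_trans u0 _; apply: pairing_trans y0 vy _.
by rewrite pairingC.
Qed.

Lemma pairing_diff (a x y : K) : << a, x >> = << a, y >> -> << a, x + y >> = 0.
Proof. by rewrite pairingDr => ->; rewrite addKK. Qed.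

(** Dual form of: two points span one line.  If a <> b, then a + b and x + y are
    nonzero and, being orthogonal to both x and y resp. to both a and b, force
    <a, x> = 0. *)
Lemma secant_unique (a b x y : K) :
  x != y -> << a, x >> = 1 -> << a, y >> = 1 -> << b, x >> = 1 -> << b, y >> = 1 ->
  a = b.
Proof.
move=> xy ax ay bx by_; apply/eqP; rewrite -eq_add0; apply/negPn/negP => ab0.
have abx : << a + b, x >> = 0 by rewrite pairingDl ax bx addKK.
have aby : << a + b, y >> = 0 by rewrite pairingDl ay by_ addKK.
have e0 : x + y != 0 by rewrite eq_add0.
have ae : << a, x + y >> = 0 by apply: pairing_diff; rewrite ax.
have abe : << a + b, x + y >> = 0 by apply: pairing_diff; rewrite abx.
by have /eqP := pairing_pencil _ _ _ x ab0 e0 abe ae abx; rewrite ax oner_eq0.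
Qed.

Lemma secant_transversal (u a x y : K) :
  u != 0 -> x != y -> << u, x >> = 0 -> << a, x >> = 1 -> << a, y >> = 1 ->
  << u, y >> != 0.
Proof.
move=> u0 xy ux ax ay; apply/eqP => uy.
have e0 : x + y != 0 by rewrite eq_add0.
have ae : << a, x + y >> = 0 by apply: pairing_diff; rewrite ax.
have ue : << u, x + y >> = 0 by apply: pairing_diff; rewrite ux.
by have /eqP := pairing_pencil _ _ _ x u0 e0 ue ae ux; rewrite ax oner_eq0.
Qed.

Definition central_chord (H : {set K}) (u : K) : {set K} :=
  [set x in H | << u, x >> == 0].

(** What the counting argument uses of a star-set, with its lines given by normal
    vectors. *)
Definition star_shaped (t : nat) (H : {set K}) : Prop :=
  [/\ #|H| = (q + t)%N, 0 \notin H &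
      forall y, y \in H ->
        exists u, [/\ u != 0, << u, y >> = 0 & #|central_chord H u| = t]].

(** The double count behind the converse.  D is the set of lines through y that
    miss the origin and off the part of H outside the star line of y; both have
    q elements.  Choosing a second point on each line of D is injective into
    off, hence onto it, so a third point on a line of D would be the chosen
    point of another line through the same two points. *)
Lemma even_chord_card (t : nat) (H : {set K}) (a : K) :
  star_shaped t H -> (forall b, ~~ odd #|chord H b|) ->
  chord H a != set0 -> #|chord H a| = 2%N.
Proof.
move=> [cardH H0 starH] even_chords /set0Pn[y].
rewrite inE => /andP[Hy /eqP ay].
have y0 : y != 0 by apply: contraNneq H0 => <-.
have [u [u0 uy card_u]] := starH y Hy.
pose off := H :\: central_chord H u; pose D := [set b | << b, y >> == 1].
have cardD : #|D| = q by rewrite card_pairing // inE expr1n.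
have card_off : #|off| = q.
  have sub_uH : central_chord H u \subset H by apply/subsetP => x /setIdP[].
  by rewrite cardsDS // cardH card_u addnK.
pose other b := odflt 0 [pick x in chord H b :\ y].
have otherP b : b \in D -> other b \in chord H b :\ y.
  rewrite inE => by1; rewrite /other; case: pickP => //= no_other.
  have := even_chords b; rewrite (cardsD1 y) inE Hy by1 /=.
  by rewrite (eq_card0 no_other).
have chordP b z : z \in chord H b :\ y -> [/\ z \in H, y != z & << b, z >> = 1].
  by rewrite !inE eq_sym => /and3P[yz Hz /eqP bz].
have Dp b : b \in D -> << b, y >> = 1 by rewrite inE => /eqP.
have offP b z : b \in D -> z \in chord H b :\ y -> z \in off.
  move=> /Dp by1 /chordP[Hz yz bz]; rewrite !inE Hz andbT /=.
  exact: (secant_transversal u b y z).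
have other_inj : {in D &, injective other}.
  move=> b c Db Dc eq_bc.
  have [_ yz bz] := chordP _ _ (otherP b Db).
  have [_ _ cz] := chordP _ _ (otherP c Dc).
  by rewrite -eq_bc in cz; apply: secant_unique yz _ bz _ cz; apply: Dp.
have other_onto : other @: D = off.
  apply/eqP; rewrite eqEcard card_in_imset // cardD card_off leqnn andbT.
  by apply/subsetP => _ /imsetP[b Db ->]; apply: offP (otherP b Db).
have Da : a \in D by rewrite inE ay.
rewrite (cardsD1 y) inE Hy ay eqxx /=; congr (_.+1).
apply/eqP/cards1P; exists (other a); apply/eqP.
rewrite eqEsubset sub1set otherP // andbT.
apply/subsetP => z az; rewrite inE.
have := offP _ _ Da az; rewrite -other_onto => /imsetP[b Db z_b].
have [_ yz az1] := chordP _ _ az; have [_ _] := chordP _ _ (otherP b Db).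
rewrite -z_b => bz.
by rewrite z_b (secant_unique _ _ _ _ yz ay az1 (Dp b Db) bz).
Qed.

(** * From the affine to the projective plane *)

Lemma mem_ag_point (x : K) : (x, 1) \in ag_point q x.
Proof.
apply/imsetP; exists 1; last by rewrite !mul1r.
by rewrite !inE oner_eq0 expr1n eqxx.
Qed.

Lemma ag_point_inj : injective (@ag_point K q).
Proof.
move=> x y exy; have: (x, 1) \in ag_point q y by rewrite -exy mem_ag_point.
by case/imsetP => c _ [-> c1]; rewrite -[c]mulr1 -c1 mul1r.
Qed.

Lemma baseFV (c : K) : c \in baseF K q -> c^-1 \in baseF K q.
Proof. by rewrite !inE exprVn => /eqP->. Qed.

Lemma ag_point_in_line (w : K * K) (x : K) :
  (ag_point q x \in pg_line q w) = (<< w.1, x >> + w.2 == 0).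
Proof.
apply/idP/idP => [/imsetP[v /setIdP[_ on_line] eq_v] | on_line].
  have: (x, 1) \in pg_point q v by rewrite -eq_v mem_ag_point.
  case/imsetP => c /setD1P[_ Fc] [-> c1].
  rewrite pairingC (pairingZ c) // pairingC -[w.2]mulr1 c1.
  by rewrite mulrCA -mulrDr mulf_eq0 on_line orbT.
apply/imsetP; exists (x, 1) => //; rewrite !inE /= expr1n mulr1 on_line eqxx.
by rewrite xpair_eqE oner_eq0 andbF.
Qed.

Definition ag_image (H : {set K}) : {set {set K * K}} := [set ag_point q x | x in H].

Lemma card_line_section (H : {set K}) (w : K * K) :
  #|ag_image H :&: pg_line q w| = #|[set x in H | << w.1, x >> + w.2 == 0]|.
Proof.
rewrite -(card_imset _ ag_point_inj); apply: eq_card => P.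
rewrite in_setI; apply/andP/imsetP => [[/imsetP[x Hx ->]]|[x]].
  by rewrite ag_point_in_line => on_line; exists x; rewrite // inE Hx.
by rewrite inE => /andP[Hx on_line] ->; rewrite imset_f ?ag_point_in_line.
Qed.

Lemma card_chord_section (H : {set K}) (w : K * K) :
  w \in hcoords K q -> w.2 != 0 ->
  #|ag_image H :&: pg_line q w| = #|chord H (w.2^-1 * w.1)|.
Proof.
move=> hw w20; rewrite card_line_section //; apply: eq_card => x.
have Fw2 : w.2 \in baseF K q by move: hw; rewrite inE => /andP[].
rewrite !inE pairingZ ?baseFV // eq_add0; congr (_ && _).
apply/eqP/eqP => [->|eq1]; first by rewrite mulVf.
by rewrite -[RHS]mulr1 -eq1 mulVKf.
Qed.

Lemma card_central_section (H : {set K}) (u : K) :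
  #|ag_image H :&: pg_line q (u, 0)| = #|central_chord H u|.
Proof.
by rewrite card_line_section; apply: eq_card => x; rewrite !inE addr0.
Qed.

(** A line through 0 that contains a point y of H is the star line of y, because
    both are the line joining 0 and y. *)
Lemma central_line_section (t : nat) (H : {set K}) (u : K) :
  star_shaped t H -> u != 0 -> #|central_chord H u| \in [:: 0; t]%N.
Proof.
move=> [_ H0 starH] u0; rewrite !inE.
have [-> | /set0Pn[y]] := eqVneq (central_chord H u) set0; first by rewrite cards0.
case/setIdP => Hy /eqP uy; have [v [v0 vy <-]] := starH y Hy.
have y0 : y != 0 by apply: contraNneq H0 => <-.
apply/orP; right; apply/eqP/eq_card => x; rewrite !inE; congr (_ && _).
by apply/eqP/eqP; [apply: (pairing_pencil u v y)|apply: (pairing_pencil v u y)].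
Qed.

(** The origin is not in H: otherwise the q / t + 1 star lines would share it and
    cover only 1 + (q / t + 1) (t - 1) < q + t points. *)
Lemma star_set_shaped (t : nat) (H : {set K}) :
  (2 <= t)%N -> star_set q t H -> star_shaped t H.
Proof.
move=> t2 [t_dvd cardH [L [L_lines cardL L0 H_cover L_sections]]].
have sub_line l y : l \in L -> y \in l ->
    exists u, [/\ u != 0, << u, y >> = 0 & #|central_chord H u| = t].
  move=> Ll ly; have:= subsetP L_lines l Ll.
  case/imset2P => u mu; rewrite inE => /eqP uu _ def_l; exists u.
  have mu0 : mu = 0.
    by have := L0 l Ll; rewrite def_l inE pairing0r add0r => /eqP.
  split.
  - by apply: contra_eq_neq uu => ->; rewrite mul0r eq_sym oner_neq0.
  - by move: ly; rewrite def_l inE mu0 addr0 => /eqP.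
  - rewrite -(L_sections l Ll) def_l mu0; apply: eq_card => x.
    by rewrite !inE addr0.
split=> //; last first.
  move=> y Hy; have /bigcupP[l Ll ly] := subsetP H_cover y Hy.
  exact: sub_line ly.
apply/negP => H0.
have: (#|H :\ 0%R| <= \sum_(l in L) #|(H :&: l) :\ 0%R|)%N.
  have -> : H :\ 0 = \bigcup_(l in L) ((H :&: l) :\ 0).
    apply/setP => x; apply/setD1P/bigcupP => [[x0 Hx]|[l Ll]].
      have /bigcupP[l Ll lx] := subsetP H_cover x Hx.
      by exists l; rewrite // !inE x0 Hx.
    by rewrite !inE => /and3P[].
  elim/big_rec2: _ => [|l n U _ le_n]; first by rewrite cards0.
  by apply: leq_trans (leq_card_setU _ _) _; rewrite leq_add2l.
rewrite (eq_bigr (fun=> t.-1)) => [|l Ll]; last first.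
  by rewrite -(L_sections l Ll) (cardsD1 0 (H :&: l)) inE H0 L0.
rewrite sum_nat_const cardL; have := cardsD1 0 H; rewrite H0 cardH add1n.
move=> eqH; rewrite -ltnS -eqH leqNgt => /negP; apply.
have q_gt0 : (0 < q)%N by rewrite expn_gt0.
have quot_gt0 : (0 < q %/ t)%N by rewrite divn_gt0 ?(dvdn_leq q_gt0) // ltnW.
rewrite -[X in (_ < X + t)%N](divnK t_dvd); move: (q %/ t)%N quot_gt0 => k k_gt0.
by case: (t) t2 => // s _; rewrite /=; lia.
Qed.

(** * KM-arcs and even chords *)

Lemma affine_hcoords (a : K) : (a, 1) \in hcoords K q.
Proof. by rewrite !inE /= expr1n eqxx xpair_eqE oner_eq0 andbF. Qed.

Lemma KM_arc_even_chord (t : nat) (H : {set K}) (a : K) :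
  ~~ odd t -> KM_arc q t (ag_image H) -> ~~ odd #|chord H a|.
Proof.
move=> even_t [_ _ sections]; have := sections _ (imset_f _ (affine_hcoords a)).
rewrite card_chord_section ?affine_hcoords ?oner_eq0 //= invr1 mul1r !inE.
by case/or3P => /eqP->.
Qed.

Lemma even_chords_KM_arc (t : nat) (H : {set K}) :
  (2 <= t)%N -> star_shaped t H -> (forall a, ~~ odd #|chord H a|) ->
  KM_arc q t (ag_image H) /\ nucleus q t (ag_image H) (ag_point q 0).
Proof.
move=> t2 shaped even_chords; have [cardH H0 _] := shaped.
have chord_card a : #|chord H a| \in [:: 0; 2]%N.
  have [-> | nonempty] := eqVneq (chord H a) set0; first by rewrite cards0.
  by rewrite (even_chord_card _ _ _ shaped).
split; split.
- by apply/subsetP => _ /imsetP[x _ ->]; apply: (imset_f _ (affine_hcoords x)).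
- by rewrite card_imset //; apply: ag_point_inj.
- move=> _ /imsetP[[u c] hw ->]; have [c0|c0] := eqVneq c 0.
    have u0 : u != 0.
      by move: hw; rewrite c0 !inE xpair_eqE eqxx andbT => /andP[].
    have := central_line_section _ _ u shaped u0.
    rewrite c0 card_central_section.
    by rewrite !inE => /orP[]/eqP->; rewrite eqxx ?orbT.
  have := chord_card (c^-1 * u); rewrite card_chord_section // !inE.
  by case/orP => /eqP->.
- exact: (imset_f _ (affine_hcoords 0)).
case: eqP => [_|t_neq2].
  by apply/imsetP => -[x Hx /ag_point_inj x0]; rewrite x0 Hx in H0.
move=> _ /andP[/imsetP[[u c] hw ->] /eqP sec].
rewrite ag_point_in_line /= pairing0r add0r; apply/negPn/negP => c0.
have := chord_card (c^-1 * u).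
rewrite -(card_chord_section _ _ hw c0) sec !inE => /orP[]/eqP // t0.
by rewrite t0 in t2.
Qed.

Lemma star_set_even (t : nat) (H : {set K}) :
  (2 <= t)%N -> star_set q t H -> ~~ odd t /\ ~~ odd #|H|.
Proof.
move=> t2 [t_dvd cardH _].
have even_t : ~~ odd t.
  have /(dvdn_pfactor _ _ (isT : prime 2))[k _ t_pow] := t_dvd.
  by move: t2; rewrite t_pow; case: k {t_pow} => // k _; rewrite oddX.
by split; rewrite // cardH oddD (negPf even_t) oddX eqn0Ngt m_gt0.
Qed.

End Plane.

Theorem theorem3 (m : nat) (hm : (1 <= m)%N) (K : finFieldType)
    (hK : #|K| = ((2 ^ m) ^ 2)%N) (t : nat) (ht : (2 <= t)%N) (H : {set K}) :
  star_set (2 ^ m) t H ->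
  ((KM_arc (2 ^ m) t [set ag_point (2 ^ m) x | x in H] /\
    nucleus (2 ^ m) t [set ag_point (2 ^ m) x | x in H] (ag_point (2 ^ m) 0))
   <-> (forall e : nat, expE m e -> power_sum H e = 0)).
Proof.
move=> star; have [even_t evenH] := star_set_even m K hm t H ht star.
apply: iff_trans (iff_sym (power_sums_even_chords m K hm hK H evenH)).
split=> [[arc _] a|even_chords]; first exact: KM_arc_even_chord even_t arc.
by apply: even_chords_KM_arc; last exact: even_chords; last exact: star_set_shaped.
Qed.
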